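(* Consider a system $(\Sigma)$ as in the context (in particular satisfying (Lip) and (Mon)) with $\mathcal{X}=\mathbb{R}^n$, $\mathcal{U}=\mathbb{R}^m$, $\mathcal{Y}=\mathbb{R}^p$ and $n\le l+p$, set $k=l+p-n$, and use the matrices and subspaces defined in the context. Let $\delta>0$, $\mathcal{P}\in\mathbb{R}^{(l+p)\times(n+k)}$ invertible, $\mathcal{K}\in\mathbb{R}^{(l+p)\times(n+k)}$, let $L_1\in\mathbb{R}^{l\times k}$, $L_2\in\mathbb{R}^{p\times k}$ be such that $\begin{bmatrix}0&L_1\\0&L_2\end{bmatrix}=\mathcal{P}^{-\top}\mathcal{K}H$, and form $\mathcal{A}$ from these $L_1,L_2$. Let $V\in\mathbb{R}^{(n+k)\times n_{\mathcal{V}}}$ and $W\in\mathbb{R}^{(n+k)\times n_{\mathcal{W}}}$ be basis matrices of the Wong limits $\mathcal{V}^*_{[\mathcal{E},\mathcal{A}]}$ and $\mathcal{W}^*_{[\mathcal{E},\mathcal{A}]}$, where $n_{\mathcal{V}},n_{\mathcal{W}}$ are their dimensions. Suppose that $$\mathcal{Q}:=\begin{bmatrix}\hat A^\top\mathcal{P}+\mathcal{P}^\top\hat A+H^\top\mathcal{K}^\top+\mathcal{K}H+\delta\mathcal{F}^\top\mathcal{F}-\mu\mathcal{J} & \mathcal{P}^\top\mathcal{B}+\hat\Theta\\ \mathcal{B}^\top\mathcal{P}+\hat\Theta^\top & -\delta\Lambda_{q_L}\end{bmatrix}<_{\mathcal{V}^*_{[[\mathcal{E},0],[\mathcal{A},\mathcal{B}]]}}0$$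 and that the following hold: (1a) $\mathcal{E}^\top\mathcal{P}=\mathcal{P}^\top\mathcal{E}\ge_{\overline{\mathcal{V}}^*_{[[\mathcal{E},0],[\mathcal{A},\mathcal{B}]]}}0$; (1b) the pencil $s\mathcal{E}-\mathcal{A}\in\mathbb{R}[s]^{(l+p)\times(n+k)}$ is regular and its index is at most one; (1c) $\|FG_L\|<1$, where $G_L:=-[I_n,0]\,W\,[0,I_{n+k-r}]\,[\mathcal{E}V,\mathcal{A}W]^{-1}\begin{bmatrix}B_L\\0\end{bmatrix}$; (1d) $JG_M$ is invertible and $\mu>\lambda_{\max}(\Gamma)$, where $G_M:=-[I_n,0]\,W\,[0,I_{n+k-r}]\,[\mathcal{E}V,\mathcal{A}W]^{-1}\begin{bmatrix}B_M\\0\end{bmatrix}$, $\tilde\Theta:=\Theta(JG_M)^{-1}$, $\Gamma:=\tilde\Theta+\tilde\Theta^\top$; (1e) there exists $\alpha>0$ such that $\|Fx\|\le\alpha\|Jx\|$ for all $x\in\mathbb{R}^n$ and, for $S:=\tilde\Theta^\top(\Gamma-\mu I_{q_M})^{-1}\tilde\Theta$, $$\frac{\alpha\|JG_L\|}{1-\|FG_L\|}\left(\sqrt{\frac{\max\{0,\lambda_{\max}(S)\}}{\mu-\lambda_{\max}(\Gamma)}}+\big\|(\Gamma-\mu I_{q_M})^{-1}(\tilde\Theta^\top-\mu I_{q_M})\big\|\right)<1 .$$ Set $\mathcal{N}:=[V,W]$, $\mathcal{M}:=[\mathcal{E}V,\mathcal{A}W]^{-1}$, $\bar{\mathcal{N}}:=[I_n,0]\mathcal{N}$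 and $\begin{bmatrix}\hat B_1\\\hat B_2\end{bmatrix}:=\mathcal{M}\begin{bmatrix}B_L&B_M&0\\0&0&I_p\end{bmatrix}$ with $\hat B_1\in\mathbb{R}^{r\times(q_L+q_M+p)}$, $\hat B_2\in\mathbb{R}^{(n+k-r)\times(q_L+q_M+p)}$. Let $$G:\mathbb{R}^r\times\mathbb{R}^{n+k-r}\times\mathbb{R}^m\times\mathbb{R}^p\to\mathbb{R}^{n+k-r},\quad (x_1,x_2,u,y)\mapsto x_2+\hat B_2\begin{pmatrix}f_L\big(\bar{\mathcal{N}}\binom{x_1}{x_2},u,y\big)\\ f_M\big(J\bar{\mathcal{N}}\binom{x_1}{x_2},u,y\big)\\ h(u)-y\end{pmatrix}$$ and $Z_0:=\{(x_1,x_2,u,y)\in\mathbb{R}^r\times\mathbb{R}^{n+k-r}\times\mathbb{R}^m\times\mathbb{R}^p: G(x_1,x_2,u,y)=0\}$. Suppose in addition that (2a) $\frac{\partial}{\partial x_2}G(x_1,x_2,u,y)$ is invertible for all $(x_1,x_2,u,y)\in Z_0$; (2b) there exists a nondecreasing $\omega\in C([0,\infty)\to(0,\infty))$ with $\int_0^\infty\frac{dt}{\omega(t)}=\infty$ such that for all $(x_1,x_2,u,y)\in Z_0$ $$\Big\|\Big(\tfrac{\partial}{\partial x_2}G(x_1,x_2,u,y)\Big)^{-1}\Big\|\,\Big\|\tfrac{\partial}{\partial(x_1,u,y)}G(x_1,x_2,u,y)\Big\|\le\omega(\|x_2\|);$$ (2c) $Z_0$ is connected; (2d) $f_M$ is locally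 Lipschitz continuous in the first variable. Then the system $(\Omega)$ with these $L_1,L_2$ is an asymptotic observer for $(\Sigma)$.
   Context: **System.** The system $(\Sigma)$ is $$\tfrac{d}{dt}Ex(t)=Ax(t)+B_Lf_L(x(t),u(t),y(t))+B_Mf_M(Jx(t),u(t),y(t)),\qquad y(t)=Cx(t)+h(u(t)),$$ where $E,A\in\mathbb{R}^{l\times n}$, $r=\operatorname{rk}E$, $B_L\in\mathbb{R}^{l\times q_L}$, $B_M\in\mathbb{R}^{l\times q_M}$, $J\in\mathbb{R}^{q_M\times n}$ with $\operatorname{rk}J=q_M$, $C\in\mathbb{R}^{p\times n}$; $\mathcal{X}\subseteq\mathbb{R}^n$, $\mathcal{U}\subseteq\mathbb{R}^m$, $\mathcal{Y}\subseteq\mathbb{R}^p$ are open, $\hat{\mathcal{X}}:=J\mathcal{X}\subseteq\mathbb{R}^{q_M}$; $h:\mathcal{U}\to\mathbb{R}^p$, $f_L:\mathcal{X}\times\mathcal{U}\times\mathcal{Y}\to\mathbb{R}^{q_L}$ and $f_M:\hat{\mathcal{X}}\times\mathcal{U}\times\mathcal{Y}\to\mathbb{R}^{q_M}$ are continuous. The nonlinearities satisfy (Lip) $\|f_L(z,u,y)-f_L(x,u,y)\|\le\|F(z-x)\|$ for all $x,z\in\mathcal{X}$, $u\in\mathcal{U}$, $y\in\mathcal{Y}$, with some $F\in\mathbb{R}^{j\times n}$, $j\in\mathbb{N}$; (Mon) $(z-x)^\top\Theta\big(f_M(z,u,y)-f_M(x,u,y)\big)\ge\frac12\mu\|z-x\|^2$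 for all $x,z\in\hat{\mathcal{X}}$, $u\in\mathcal{U}$, $y\in\mathcal{Y}$, with some $\Theta\in\mathbb{R}^{q_M\times q_M}$, $\mu\in\mathbb{R}$ ($\mu<0$ and singular $\Theta$ are allowed). Set $B:=[B_L,B_M]$ and $f(x,u,y):=\begin{pmatrix}f_L(x,u,y)\\ f_M(Jx,u,y)\end{pmatrix}$. Convention: if only the Lipschitz part $f_L$ is present ($q_M=0$), conditions (1d) and (1e) are not present; if only the monotone part $f_M$ is present ($q_L=0$), conditions (1c) and (1e) are not present. **Observer candidate.** For $L_1\in\mathbb{R}^{l\times k}$, $L_2\in\mathbb{R}^{p\times k}$ the system $(\Omega)$ is $$\tfrac{d}{dt}Ez(t)=Az(t)+Bf(z(t),u(t),y(t))+L_1d(t),\qquad 0=Cz(t)-y(t)+h(u(t))+L_2d(t),$$ with state $x_o=\binom{z}{d}$ taking values in $\mathcal{X}_o=\mathcal{X}\times\mathbb{R}^k$, inputs $u,y$ and output $z$. **Solutions.** A solution of $(\Sigma)$ on an open interval $I$ is a triple $(x,u,y)\in C(I\to\mathcal{X}\times\mathcal{U}\times\mathcal{Y})$ with $x\in C^1$ satisfying the equations for all $t\in I$. A solution of $(\Omega)$ on $I$ is $\big(\binom{z}{d},\binom{u}{y},z\big)$ with $\binom{z}{d}\in C^1(I\to\mathcal{X}\times\mathbb{R}^k)$, $(u,y)\in C(I\to\mathcal{U}\times\mathcal{Y})$ satisfying the equations for all $t\in I$. The behaviors $\mathfrak{B}_\Sigma,\mathfrak{B}_\Omega$ are the sets of all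 solutions on all open intervals $I\subseteq\mathbb{R}$. **Acceptor, observer, state estimator, asymptotic observer.** $(\Omega)$ is an acceptor for $(\Sigma)$ if for every $(x,u,y)\in\mathfrak{B}_\Sigma$ with domain $I$ there is $\binom{z}{d}\in C^1(I\to\mathcal{X}\times\mathbb{R}^k)$ with $\big(\binom{z}{d},\binom{u}{y},z\big)\in\mathfrak{B}_\Omega$. It is an observer for $(\Sigma)$ if it is an acceptor and for every open interval $I$, every $t_0\in I$ and all solutions $(x,u,y)$ of $(\Sigma)$ and $\big(\binom{z}{d},\binom{u}{y},z\big)$ of $(\Omega)$ on $I$ (same $u,y$), $Ez(t_0)=Ex(t_0)$ implies $z=x$ on $I$. It is a state estimator for $(\Sigma)$ if it is an acceptor and for all $t_0\in\mathbb{R}$, whenever $(x,u,y)$ and $\big(\binom{z}{d},\binom{u}{y},z\big)$ (same $u,y$) are solutions of $(\Sigma)$ and $(\Omega)$ on $[t_0,\infty)$ (i.e. restrictions to $[t_0,\infty)$ of elements of $\mathfrak{B}_\Sigma$, $\mathfrak{B}_\Omega$), then $\lim_{t\to\infty}(z(t)-x(t))=0$. It is an asymptotic observer for $(\Sigma)$ if it is both an observer and a state estimator for $(\Sigma)$. **Matrices.** $\mathcal{E}=\begin{bmatrix}E&0\\0&0\end{bmatrix}$, $\mathcal{A}=\begin{bmatrix}A&L_1\\C&L_2\end{bmatrix}$, $\hat A=\begin{bmatrix}A&0\\C&0\end{bmatrix}$ in $\mathbb{R}^{(l+p)\times(n+k)}$; $\mathcal{B}=\begin{bmatrix}B\\0\end{bmatrix}\in\mathbb{R}^{(l+p)\times(q_L+q_M)}$;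 $H=\begin{bmatrix}0_{n\times n}&0\\0&I_k\end{bmatrix}$; $\mathcal{F}=[F,0]\in\mathbb{R}^{j\times(n+k)}$; $\hat\Theta=\begin{bmatrix}0&J^\top\Theta\\0&0\end{bmatrix}\in\mathbb{R}^{(n+k)\times(q_L+q_M)}$; $\mathcal{J}=\begin{bmatrix}J^\top J&0\\0&0\end{bmatrix}\in\mathbb{R}^{(n+k)\times(n+k)}$; $\Lambda_{q_L}=\begin{bmatrix}I_{q_L}&0\\0&0\end{bmatrix}\in\mathbb{R}^{(q_L+q_M)\times(q_L+q_M)}$. $\lambda_{\max}(M)$ denotes the largest eigenvalue of $M$; $\|\cdot\|$ is the Euclidean norm and the induced matrix norm. **Wong limits.** For matrices $M,N$ of equal size $a\times b$: $\mathcal{V}^0_{[M,N]}:=\mathbb{R}^b$, $\mathcal{V}^{i+1}_{[M,N]}:=N^{-1}(M\mathcal{V}^i_{[M,N]})$, $\mathcal{V}^*_{[M,N]}:=\bigcap_{i\in\mathbb{N}_0}\mathcal{V}^i_{[M,N]}$; $\mathcal{W}^0_{[M,N]}:=\{0\}$, $\mathcal{W}^{i+1}_{[M,N]}:=M^{-1}(N\mathcal{W}^i_{[M,N]})$, $\mathcal{W}^*_{[M,N]}:=\bigcup_{i\in\mathbb{N}_0}\mathcal{W}^i_{[M,N]}$ (with $M^{-1},N^{-1}$ denoting preimages). $\overline{\mathcal{V}}^*_{[[\mathcal{E},0],[\mathcal{A},\mathcal{B}]]}:=[I_{n+k},0]\,\mathcal{V}^*_{[[\mathcal{E},0],[\mathcal{A},\mathcal{B}]]}$,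 where $[\mathcal{E},0],[\mathcal{A},\mathcal{B}]\in\mathbb{R}^{(l+p)\times(n+k+q_L+q_M)}$. **Regularity and index.** A square pencil $sM-N\in\mathbb{R}[s]^{a\times a}$ is regular if $\det(sM-N)\ne0\in\mathbb{R}[s]$. Then there are invertible $S_0,T_0\in\mathbb{R}^{a\times a}$ with $S_0(sM-N)T_0=s\begin{bmatrix}I_\rho&0\\0&N_0\end{bmatrix}-\begin{bmatrix}J_0&0\\0&I_{a-\rho}\end{bmatrix}$, $N_0$ nilpotent; the index is $0$ if $\rho=a$ and $\min\{i\in\mathbb{N}: N_0^i=0\}$ if $\rho<a$ (independent of the choice of $S_0,T_0$). **Definiteness on a subspace.** $M<_V0$ means $x^\top Mx<0$ for all $x\in V\setminus\{0\}$; $M\ge_V0$ means $x^\top Mx\ge0$ for all $x\in V$. *)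

(* Defs.v *)
From HB Require Import structures.
From mathcomp Require Import all_boot all_order all_algebra.
From mathcomp Require Import all_classical all_reals all_analysis.

Set Implicit Arguments.
Unset Strict Implicit.
Unset Printing Implicit Defensive.

Import Order.TTheory GRing.Theory Num.Theory.
Import numFieldNormedType.Exports.

Local Open Scope classical_set_scope.
Local Open Scope ring_scope.

(* The library norm on 'cV[R]_n is the maximum norm; all estimates here are    *)
(* with respect to the Euclidean norm and the matrix norm it induces.          *)
Definition enorm (R : realType) n (x : 'cV[R]_n) : R :=
  Num.sqrt (\sum_i x i 0 ^+ 2).

(* "<= 1" rather than "= 1", so that the set is nonempty also for n = 0.       *)
Definition opnorm (R : realType) m n (A : 'M[R]_(m, n)) : R :=
  sup [set enorm (A *m x) | x in [set x : 'cV[R]_n | enorm x <= 1]].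

(* Only applied to symmetric matrices of positive size: the set of real        *)
(* eigenvalues is then finite and nonempty, and sup is its maximum.            *)
Definition lambda_max (R : realType) q (M : 'M[R]_q) : R :=
  sup [set a : R | eigenvalue M a].

(* Several matrices below are square only because n + k = l + p. For           *)
(* A : 'M_(m, n) with m and n not convertible, "A is invertible" means that A  *)
(* has full row and column rank; pinvmx A is then its two-sided inverse.       *)
Definition invertible_mx (R : fieldType) m n (A : 'M[R]_(m, n)) : bool :=
  row_free A && row_full A.

Lemma invertible_mx_square (R : fieldType) m n (A : 'M[R]_(m, n)) :
  invertible_mx A -> m = n.
Proof. by rewrite /invertible_mx /row_free /row_full => /andP[/eqP Af /eqP AF]; rewrite -Af AF. Qed.

Lemma invertible_mxP (R : fieldType) m n (A : 'M[R]_(m, n)) :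
  invertible_mx A -> A *m pinvmx A = 1%:M /\ pinvmx A *m A = 1%:M.
Proof. by case/andP => Af AF; rewrite mulmxVp // mulVpmx. Qed.

Section WongSequences.
Context {R : realType} {a b : nat}.
Implicit Types M N : 'M[R]_(a, b).

Fixpoint wongV M N (i : nat) : set 'cV[R]_b :=
  if i is i'.+1 then mulmx N @^-1` (mulmx M @` wongV M N i') else setT.

Fixpoint wongW M N (i : nat) : set 'cV[R]_b :=
  if i is i'.+1 then mulmx M @^-1` (mulmx N @` wongW M N i') else [set 0].

Definition wongV_lim M N : set 'cV[R]_b := \bigcap_i wongV M N i.
Definition wongW_lim M N : set 'cV[R]_b := \bigcup_i wongW M N i.

End WongSequences.

Definition basis_matrix (R : fieldType) b d (V : 'M[R]_(b, d))
    (U : set 'cV[R]_b) : Prop :=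
  U = range (mulmx V : 'cV[R]_d -> 'cV[R]_b) /\ \rank V = d.

Definition neg_def_on (R : realType) b (M : 'M[R]_b) (U : set 'cV[R]_b) :=
  forall x, U x -> x != 0 -> (x^T *m M *m x) 0 0 < 0.

Definition pos_semidef_on (R : realType) b (M : 'M[R]_b) (U : set 'cV[R]_b) :=
  forall x, U x -> 0 <= (x^T *m M *m x) 0 0.

Section Pencils.
Context {R : fieldType} {a b : nat}.
Implicit Types M N : 'M[R]_(a, b).

Definition pencil M N : 'M[{poly R}]_(a, b) :=
  'X *: map_mx polyC M - map_mx polyC N.

(* The pencil is square and its determinant is not the zero polynomial.        *)
Definition regular_pencil M N : Prop :=
  exists e : b = a, \det (castmx (erefl a, e) (pencil M N)) != 0.

(* S0 (s M - N) T0 = s diag(I, N0) - diag(J0, I), coefficientwise in s; the    *)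
(* invertibility of S0 and T0 forces rho + c = a = b, i.e. c = a - rho.        *)
Definition weierstrass_form M N rho c (J0 : 'M[R]_rho) (N0 : 'M[R]_c) : Prop :=
  exists (S0 : 'M[R]_(rho + c, a)) (T0 : 'M[R]_(b, rho + c)),
    [/\ invertible_mx S0, invertible_mx T0,
        S0 *m M *m T0 = block_mx 1%:M 0 0 N0,
        S0 *m N *m T0 = block_mx J0 0 0 1%:M
      & exists i, N0 ^+ i = 0].

Definition has_index M N (nu : nat) : Prop :=
  exists rho c (J0 : 'M[R]_rho) (N0 : 'M[R]_c),
    weierstrass_form M N J0 N0 /\
    (if c == 0%N then nu = 0%N
     else [/\ (0 < nu)%N, N0 ^+ nu = 0
            & forall i, (0 < i)%N -> N0 ^+ i = 0 -> (nu <= i)%N]).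

End Pencils.

Section Solutions.
Context {R : realType} {l n qL qM m p k : nat}.
Variables (E A : 'M[R]_(l, n)) (BL : 'M[R]_(l, qL)) (BM : 'M[R]_(l, qM)).
Variables (J : 'M[R]_(qM, n)) (C : 'M[R]_(p, n)).
Variables (h : 'cV[R]_m -> 'cV[R]_p).
Variables (fL : 'cV[R]_n -> 'cV[R]_m -> 'cV[R]_p -> 'cV[R]_qL).
Variables (fM : 'cV[R]_qM -> 'cV[R]_m -> 'cV[R]_p -> 'cV[R]_qM).
Variables (L1 : 'M[R]_(l, k)) (L2 : 'M[R]_(p, k)).

Definition open_interval (I : set R) : Prop := open I /\ is_interval I.

Definition C1_on (V : normedModType R) (I : set R) (x : R -> V) : Prop :=
  (forall t, I t -> derivable x t 1) /\ {within I, continuous (derive1 x)}.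

(* A function on an interval I is represented by a total function of which     *)
(* only the values on I matter.                                                *)
Definition Sigma_behavior (I : set R) (x : R -> 'cV[R]_n) (u : R -> 'cV[R]_m)
    (y : R -> 'cV[R]_p) : Prop :=
  [/\ open_interval I, C1_on I x,
      {within I, continuous u}, {within I, continuous y}
    & forall t, I t ->
        derive1 (fun s => E *m x s) t =
          A *m x t + BL *m fL (x t) (u t) (y t)
                   + BM *m fM (J *m x t) (u t) (y t)
        /\ y t = C *m x t + h (u t)].

Definition Omega_behavior (I : set R) (z : R -> 'cV[R]_n) (d : R -> 'cV[R]_k)
    (u : R -> 'cV[R]_m) (y : R -> 'cV[R]_p) : Prop :=
  [/\ open_interval I, C1_on I z /\ C1_on I d,
      {within I, continuous u}, {within I, continuous y}
    & forall t, I t ->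
        derive1 (fun s => E *m z s) t =
          A *m z t
          + row_mx BL BM *m
              col_mx (fL (z t) (u t) (y t)) (fM (J *m z t) (u t) (y t))
          + L1 *m d t
        /\ 0 = C *m z t - y t + h (u t) + L2 *m d t].

(* Restrictions to [t0, +oo[ of elements of the behaviors; the two elements    *)
(* may have different domains.                                                 *)
Definition Sigma_solution_from (t0 : R) (x : R -> 'cV[R]_n)
    (u : R -> 'cV[R]_m) (y : R -> 'cV[R]_p) : Prop :=
  exists (I : set R) x' u' y',
    [/\ `[t0, +oo[ `<=` I, Sigma_behavior I x' u' y'
      & forall t, t0 <= t -> [/\ x t = x' t, u t = u' t & y t = y' t]].

Definition Omega_solution_from (t0 : R) (z : R -> 'cV[R]_n)
    (d : R -> 'cV[R]_k) (u : R -> 'cV[R]_m) (y : R -> 'cV[R]_p) : Prop :=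
  exists (I : set R) z' d' u' y',
    [/\ `[t0, +oo[ `<=` I, Omega_behavior I z' d' u' y'
      & forall t, t0 <= t ->
          [/\ z t = z' t, d t = d' t, u t = u' t & y t = y' t]].

Definition acceptor : Prop :=
  forall I x u y, Sigma_behavior I x u y ->
    exists z d, Omega_behavior I z d u y.

Definition observer : Prop :=
  acceptor /\
  forall I (t0 : R) x z d u y, I t0 ->
    Sigma_behavior I x u y -> Omega_behavior I z d u y ->
    E *m z t0 = E *m x t0 -> forall t, I t -> z t = x t.

Definition state_estimator : Prop :=
  acceptor /\
  forall (t0 : R) (x z : R -> 'cV[R]_n) d u y,
    Sigma_solution_from t0 x u y -> Omega_solution_from t0 z d u y ->
    z t - x t @[t --> +oo] --> (0 : 'cV[R]_n).

Definition asymptotic_observer : Prop := observer /\ state_estimator.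

End Solutions.

Section Matrices.
Context {R : realType} {l n p k qL qM j : nat}.

Definition calE (E : 'M[R]_(l, n)) : 'M[R]_(l + p, n + k) := block_mx E 0 0 0.
Definition calA (A : 'M[R]_(l, n)) (C : 'M[R]_(p, n)) (L1 : 'M[R]_(l, k))
  (L2 : 'M[R]_(p, k)) : 'M[R]_(l + p, n + k) := block_mx A L1 C L2.
Definition hatA (A : 'M[R]_(l, n)) (C : 'M[R]_(p, n)) :
  'M[R]_(l + p, n + k) := block_mx A 0 C 0.
Definition calB (BL : 'M[R]_(l, qL)) (BM : 'M[R]_(l, qM)) :
  'M[R]_(l + p, qL + qM) := col_mx (row_mx BL BM) 0.
Definition matH : 'M[R]_(n + k) := block_mx 0 0 0 1%:M.
Definition calF (F : 'M[R]_(j, n)) : 'M[R]_(j, n + k) := row_mx F 0.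
Definition hatTheta (J : 'M[R]_(qM, n)) (Theta : 'M[R]_qM) :
  'M[R]_(n + k, qL + qM) := block_mx 0 (J^T *m Theta) 0 0.
Definition calJ (J : 'M[R]_(qM, n)) : 'M[R]_(n + k) :=
  block_mx (J^T *m J) 0 0 0.
Definition Lambda : 'M[R]_(qL + qM) := block_mx 1%:M 0 0 0.

(* K is typed as an (n + k) x (n + k) matrix: as l + p = n + k these are the   *)
(* (l + p) x (n + k) matrices, and K H + (K H)^T needs no cast.                *)
Definition calQ (A : 'M[R]_(l, n)) (C : 'M[R]_(p, n))
    (BL : 'M[R]_(l, qL)) (BM : 'M[R]_(l, qM)) (F : 'M[R]_(j, n))
    (J : 'M[R]_(qM, n)) (Theta : 'M[R]_qM) (mu delta : R)
    (P : 'M[R]_(l + p, n + k)) (K : 'M[R]_(n + k)) :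
    'M[R]_((n + k) + (qL + qM)) :=
  block_mx
    ((hatA A C)^T *m P + P^T *m hatA A C + matH^T *m K^T + K *m matH
       + delta *: ((calF F)^T *m calF F) - mu *: calJ J)
    (P^T *m calB BL BM + hatTheta J Theta)
    ((calB BL BM)^T *m P + (hatTheta J Theta)^T)
    (- (delta *: Lambda)).

(* For a regular pencil of index at most one, V* and W* have dimensions        *)
(* nV = rk E and nW = n + k - rk E; the block sizes are expressed by nV, nW.   *)
Definition calM nV nW (cE cA : 'M[R]_(l + p, n + k)) (V : 'M[R]_(n + k, nV))
    (W : 'M[R]_(n + k, nW)) : 'M[R]_(nV + nW, l + p) :=
  pinvmx (row_mx (cE *m V) (cA *m W)).

(* G_L and G_M are the instances B0 = B_L and B0 = B_M.                        *)
Definition gain nV nW q (cE cA : 'M[R]_(l + p, n + k))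
    (V : 'M[R]_(n + k, nV)) (W : 'M[R]_(n + k, nW)) (B0 : 'M[R]_(l, q)) :
    'M[R]_(n, q) :=
  - ((row_mx 1%:M 0 : 'M[R]_(n, n + k)) *m W
       *m (row_mx 0 1%:M : 'M[R]_(nW, nV + nW))
       *m calM cE cA V W *m (col_mx B0 0 : 'M[R]_(l + p, q))).

End Matrices.

(* The library's jacobian is for functions of row vectors.                     *)
Definition cjacobian (R : realType) a b (f : 'cV[R]_a -> 'cV[R]_b)
    (x : 'cV[R]_a) : 'M[R]_(b, a) :=
  \matrix_(i, j) ('d f x (delta_mx j 0 : 'cV[R]_a)) i 0.

Section ConstraintFunction.
Context {R : realType} {n m p qL qM nV nW : nat}.

Definition Gfun (Nbar : 'M[R]_(n, nV + nW)) (J : 'M[R]_(qM, n))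
    (hatB2 : 'M[R]_(nW, (qL + qM) + p)) (h : 'cV[R]_m -> 'cV[R]_p)
    (fL : 'cV[R]_n -> 'cV[R]_m -> 'cV[R]_p -> 'cV[R]_qL)
    (fM : 'cV[R]_qM -> 'cV[R]_m -> 'cV[R]_p -> 'cV[R]_qM)
    (x1 : 'cV[R]_nV) (x2 : 'cV[R]_nW) (u : 'cV[R]_m) (y : 'cV[R]_p) :
    'cV[R]_nW :=
  x2 + hatB2 *m
    col_mx (col_mx (fL (Nbar *m col_mx x1 x2) u y)
                   (fM (J *m Nbar *m col_mx x1 x2) u y))
           (h u - y).

Variable G : 'cV[R]_nV -> 'cV[R]_nW -> 'cV[R]_m -> 'cV[R]_p -> 'cV[R]_nW.

Definition zero_set : set ('cV[R]_nV * 'cV[R]_nW * 'cV[R]_m * 'cV[R]_p) :=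
  [set w | G w.1.1.1 w.1.1.2 w.1.2 w.2 = 0].

Definition G_x2 x1 u y : 'cV[R]_nW -> 'cV[R]_nW := fun x2 => G x1 x2 u y.

(* The argument of this function is the stacked vector (x1; u; y).             *)
Definition G_x1uy x2 : 'cV[R]_(nV + (m + p)) -> 'cV[R]_nW :=
  fun w => G (usubmx w) x2 (usubmx (dsubmx w)) (dsubmx (dsubmx w)).

End ConstraintFunction.

(* Main.v *)
Require Import Defs.
From mathcomp Require Import all_boot all_order all_algebra.
From mathcomp Require Import all_classical all_reals all_analysis.
From mathcomp Require Import ring lra.

(** The error [w = (z - x; d)] and the mismatch [phi] of the nonlinearities
    satisfy the linear differential-algebraic equation
      [calE w' = calA w + calB phi]  ([error_dae]).
    Since [s calE - calA] is regular of index at most one, it decomposes into an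
    ordinary differential equation for the dynamic component [y] of [w] and a
    constraint that expresses [w] by [y] and [phi]. The pairs [(w, phi)] that
    satisfy the constraint belong to the Wong limit on which [Q] is negative
    definite ([graph_wongV]).

    On such pairs the form [Q] equals the derivative of the Lyapunov function
    [v = w^T calE^T P w] plus a supply rate ([calQ_form]), and the supply rate is
    nonnegative by the Lipschitz and the monotonicity condition ([supply_ge0]).
    So [v' <= - eps (|y|^2 + |phi|^2)]. On the other hand, [v'] is a bilinear
    expression in [y] and [y'], because [calE] annihilates the algebraic
    component of [w]. It is at most of the order of [|y| (|y| + |phi|)], and the
    two facts together force [|phi| <= const |y|]; hence also [|w|] and [|y'|]
    are bounded by a multiple of [|y|] ([dissipation_estimates]).

    The system state with [d = 0] solves the observer equations, which gives the
    acceptor property. If [E z = E x] at one time, then [y] vanishes there, and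
    [|y'| <= const |y|] keeps [y] equal to zero on the whole interval
    ([gronwall_zero]), so [w = 0]: this is the observer property. Finally, on a
    half-line, [v >= 0] decreases at least at the rate [eps |y|^2] while [|y|^2]
    decays at most exponentially, and therefore [y], and with it [w], tends to
    zero ([lyapunov_cvg0]). *)

Set Implicit Arguments.
Unset Strict Implicit.
Unset Printing Implicit Defensive.

Import Order.TTheory GRing.Theory Num.Theory.
Import numFieldNormedType.Exports.

Local Open Scope classical_set_scope.
Local Open Scope ring_scope.

(** * Quadratic forms *)

Section QuadraticForms.
Context {R : realType}.

Definition bform a b (M : 'M[R]_(a, b)) (x : 'cV[R]_a) (y : 'cV[R]_b) : R :=
  (x^T *m M *m y) 0 0.

(** The squared Euclidean norm; unlike the norm itself it is differentiable
    along a trajectory and additive over stacked vectors. *)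
Definition sqn a (x : 'cV[R]_a) : R := \sum_i x i 0 ^+ 2.

Lemma sqn_ge0 a (x : 'cV[R]_a) : 0 <= sqn x.
Proof. by apply: sumr_ge0 => i _; rewrite sqr_ge0. Qed.

Lemma sqnE a (x : 'cV[R]_a) : sqn x = (x^T *m x) 0 0.
Proof. by rewrite mxE; apply: eq_bigr => i _; rewrite mxE expr2. Qed.

Lemma sqn_enorm a (x : 'cV[R]_a) : enorm x ^+ 2 = sqn x.
Proof. by rewrite sqr_sqrtr// sqn_ge0. Qed.

Lemma le_sqr_sqn a (x : 'cV[R]_a) i : x i 0 ^+ 2 <= sqn x.
Proof.
by rewrite /sqn (bigD1 i)//= lerDl sumr_ge0// => j _; rewrite sqr_ge0.
Qed.

Lemma sqn_eq0 a (x : 'cV[R]_a) : sqn x = 0 -> x = 0.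
Proof.
move=> x0; apply/colP => i; rewrite mxE; apply/eqP.
by rewrite -sqrf_eq0 eq_le sqr_ge0 -x0 le_sqr_sqn.
Qed.

Lemma sqn_col_mx a b (x : 'cV[R]_a) (y : 'cV[R]_b) :
  sqn (col_mx x y) = sqn x + sqn y.
Proof.
by rewrite /sqn big_split_ord/=; congr (_ + _); apply: eq_bigr => i _;
  rewrite ?col_mxEu ?col_mxEd.
Qed.

Lemma bform_sum a b (M : 'M[R]_(a, b)) x y :
  bform M x y = \sum_i \sum_j x i 0 * M i j * y j 0.
Proof.
rewrite /bform -mulmxA mxE; apply: eq_bigr => i _.
rewrite !mxE mulr_sumr; apply: eq_bigr => j _.
by rewrite mulrA.
Qed.

Lemma bformC a b (M : 'M[R]_(a, b)) x y : bform M x y = bform M^T y x.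
Proof.
rewrite /bform -mulmxA -[y^T *m _]trmx_mul.
by rewrite -[in RHS](trmxK x) -trmx_mul [RHS]mxE.
Qed.

Lemma bform_mul a b c d (U : 'M[R]_(a, c)) (M : 'M[R]_(a, b))
    (V : 'M[R]_(b, d)) x y :
  bform (U^T *m M *m V) x y = bform M (U *m x) (V *m y).
Proof. by rewrite /bform trmx_mul !mulmxA. Qed.

Lemma bform_mull a b c (U : 'M[R]_(a, c)) (M : 'M[R]_(a, b)) x y :
  bform (U^T *m M) x y = bform M (U *m x) y.
Proof. by rewrite /bform trmx_mul !mulmxA. Qed.

Lemma bform_mulr a b c (M : 'M[R]_(a, b)) (U : 'M[R]_(b, c)) x y :
  bform (M *m U) x y = bform M x (U *m y).
Proof. by rewrite /bform !mulmxA. Qed.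

Lemma bform_block a b (A : 'M[R]_a) (B : 'M[R]_(a, b)) (C : 'M[R]_(b, a))
    (D : 'M[R]_b) x y :
  bform (block_mx A B C D) (col_mx x y) (col_mx x y) =
  bform A x x + bform B x y + (bform C y x + bform D y y).
Proof.
rewrite /bform -!mulmxA mul_block_col tr_col_mx mul_row_col !mulmxDr.
by rewrite !mxE.
Qed.

Lemma bformDm a b (M N : 'M[R]_(a, b)) x y :
  bform (M + N) x y = bform M x y + bform N x y.
Proof. by rewrite /bform mulmxDr mulmxDl mxE. Qed.

Lemma bformNm a b (M : 'M[R]_(a, b)) x y : bform (- M) x y = - bform M x y.
Proof. by rewrite /bform mulmxN mulNmx mxE. Qed.

Lemma bformZm a b c (M : 'M[R]_(a, b)) x y :
  bform (c *: M) x y = c * bform M x y.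
Proof. by rewrite /bform -scalemxAr -scalemxAl mxE. Qed.

Lemma bformDr a b (M : 'M[R]_(a, b)) x y z :
  bform M x (y + z) = bform M x y + bform M x z.
Proof. by rewrite /bform mulmxDr mxE. Qed.

Lemma bform_gram a b (M : 'M[R]_(a, b)) x : bform (M^T *m M) x x = sqn (M *m x).
Proof. by rewrite bform_mull /bform -mulmxA -sqnE. Qed.

(** Young's inequality for bilinear forms: the weight of [y] may be made as
    small as wanted, at the price of a large weight on [x]. *)
Lemma bform_le a b (M : 'M[R]_(a, b)) (eps : R) : 0 < eps ->
  exists2 c, 0 <= c &
    forall x y, `|bform M x y| <= c * sqn x + eps * sqn y.
Proof.
move=> e0; pose m : R := 1 + \sum_i \sum_j `|M i j|.
have m0 : 0 < m.
  by rewrite ltr_pwDl// sumr_ge0// => i _; rewrite sumr_ge0.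
exists (m ^+ 2 / eps); first by rewrite divr_ge0 ?sqr_ge0// ltW.
move=> x y; rewrite bform_sum.
(* 2 |x_i| |y_j| <= x_i^2 / d + d y_j^2, with d chosen so that m d = eps *)
pose d := eps / m; have d0 : 0 < d by rewrite divr_gt0.
have H i j : `|x i 0 * M i j * y j 0| <=
    `|M i j| * (d^-1 * sqn x + d * sqn y).
  rewrite -mulrA mulrCA !normrM ler_wpM2l//.
  have hx := le_sqr_sqn x i; have hy := le_sqr_sqn y j.
  apply: (@le_trans _ _ (d^-1 * x i 0 ^+ 2 + d * y j 0 ^+ 2)); last first.
    by rewrite lerD// ler_wpM2l// ltW// invr_gt0.
  rewrite -(real_normK (num_real (x i 0))) -(real_normK (num_real (y j 0))).
  have : 0 <= d^-1 * (`|x i 0| - d * `|y j 0|) ^+ 2.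
    by rewrite mulr_ge0 ?sqr_ge0// ltW// invr_gt0.
  have -> : d^-1 * (`|x i 0| - d * `|y j 0|) ^+ 2 =
     d^-1 * `|x i 0| ^+ 2 + d * `|y j 0| ^+ 2 - 2 * (`|x i 0| * `|y j 0|).
    by field; rewrite gt_eqF.
  have : 0 <= `|x i 0| * `|y j 0| by rewrite mulr_ge0.
  lra.
apply: (@le_trans _ _ ((m - 1) * (d^-1 * sqn x + d * sqn y))).
  rewrite (le_trans (ler_norm_sum _ _ _))// /m addrC addKr mulr_suml.
  apply: ler_sum => i _; rewrite (le_trans (ler_norm_sum _ _ _))// mulr_suml.
  by apply: ler_sum => j' _; exact: H.
have -> : m ^+ 2 / eps * sqn x + eps * sqn y =
    m * (d^-1 * sqn x + d * sqn y).
  by rewrite /d; field; rewrite !gt_eqF.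
rewrite ler_wpM2r ?gerBl// addr_ge0// mulr_ge0 ?sqn_ge0// ?ltW//.
by rewrite invr_gt0.
Qed.

Lemma sqn_mulmx_le a b (M : 'M[R]_(a, b)) :
  exists2 c, 0 <= c & forall x, sqn (M *m x) <= c * sqn x.
Proof.
have [c c0 H] := @bform_le b b (M^T *m M) 1 ltr01.
exists (c + 1); first lra.
move=> x; have := H x x; rewrite /bform !mulmxA -trmx_mul -mulmxA -sqnE.
by rewrite ger0_norm ?sqn_ge0// mulrDl.
Qed.

(** A form that is negative away from the origin has a negative maximum on the
    compact unit sphere, and homogeneity spreads this gap to the whole space.
    The maximum norm is used for the sphere: it metrizes the topology of row
    vectors in which closed bounded sets are compact. *)
Lemma neg_def_bound a (M : 'M[R]_a) :
  (forall x, x != 0 -> bform M x x < 0) ->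
  exists2 eps, 0 < eps & forall x, bform M x x <= - eps * sqn x.
Proof.
move=> Mneg.
pose f (v : 'rV[R]_a) := bform M v^T v^T.
pose S := [set v : 'rV[R]_a | `|v| = 1].
have fcont : continuous f.
  have -> : f = fun w : 'rV[R]_a => \sum_i \sum_j w 0 i * M i j * w 0 j.
    apply/funext => w; rewrite /f bform_sum; apply: eq_bigr => i _.
    by apply: eq_bigr => j _; rewrite !mxE.
  apply: continuous_big => [|i _]; first exact: add_continuous.
  apply: continuous_big => [|j _ v]; first exact: add_continuous.
  have coordc := @coord_continuous R 1 a 0.
  apply: (@cvgM _ _ (nbhs v) _ (fun w : 'rV[R]_a => w 0 i * M i j)).
    exact: (@cvgM _ _ (nbhs v) _ (fun w : 'rV[R]_a => w 0 i) _ _ _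
      (coordc i v) (cvg_cst _)).
  exact: coordc.
have Scomp : compact S.
  apply: bounded_closed_compact.
    by exists 1; split => // x x1 v /= ->; exact: ltW.
  have -> : S = (fun v : 'rV[R]_a => `|v|) @^-1` [set 1] by [].
  apply: closed_comp => [v _|]; last exact: closed_eq.
  exact: norm_continuous.
have normsq (v : 'rV[R]_a) : sqn v^T <= a%:R * `|v| ^+ 2.
  rewrite /sqn; apply: (@le_trans _ _ (\sum_(i < a) `|v| ^+ 2)).
    apply: ler_sum => i _; rewrite mxE -(real_normK (num_real (v 0 i))).
    rewrite lerXn2r ?nnegrE//.
    rewrite [leRHS]/Num.Def.normr/= mx_normrE.
    exact: (le_bigmax _ (fun i => `|v i.1 i.2|) (0, i)).
  by rewrite sumr_const card_ord mulr_natl.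
(* the sphere is empty when a = 0 *)
have [S0|S0] := pselect (S !=set0); last first.
  exists 1 => // x; have [->|x0] := eqVneq x 0.
    by rewrite /bform mulmx0 mxE /sqn big1 ?mulr0// => i _; rewrite mxE expr0n.
  exfalso; apply: S0; exists (`|x^T|^-1 *: x^T).
  rewrite /S/= normrZ normfV normr_id mulVf// normr_eq0.
  by apply: contra x0 => /eqP h; rewrite -(trmxK x) h trmx0.
have [v /set_mem Sv vmax] := EVT_max_rV S0 Scomp (continuous_subspaceT fcont).
have v0 : v != 0 by rewrite -normr_eq0 Sv oner_eq0.
have fv : f v < 0.
  by apply: Mneg; apply: contra v0 => /eqP h; rewrite -(trmxK v) h trmx0.
have a0 : 0 < a.+1%:R :> R by rewrite ltr0Sn.
exists (- f v / a.+1%:R); first by rewrite divr_gt0// oppr_gt0.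
move=> x; have [->|x0] := eqVneq x 0.
  by rewrite /bform mulmx0 mxE /sqn big1 ?mulr0// => i _; rewrite mxE expr0n.
have nx0 : 0 < `|x^T|.
  rewrite normr_gt0; apply: contra x0 => /eqP h.
  by rewrite -(trmxK x) h trmx0.
have := vmax (`|x^T|^-1 *: x^T); rewrite inE /S/= normrZ normfV normr_id.
rewrite mulVf ?gt_eqF// => /(_ erefl).
rewrite {1}/f /bform linearZ/= trmxK -scalemxAr linearZ/= -!scalemxAl !mxE.
rewrite -/(bform M x x) mulrA -expr2 exprVn -ler_pdivlMl ?invr_gt0 ?exprn_gt0//.
rewrite invrK => h; apply: le_trans h _.
have := normsq x^T; rewrite trmxK => hx.
rewrite [leLHS]mulrC -subr_ge0.
have -> : - (- f v / a.+1%:R) * sqn x - f v * `|x^T| ^+ 2 =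
    - f v * (a.+1%:R^-1 * (a.+1%:R * `|x^T| ^+ 2 - sqn x)).
  by field; rewrite gt_eqF.
rewrite mulr_ge0 ?oppr_ge0 ?(ltW fv)// mulr_ge0 ?invr_ge0 ?ler0n//.
rewrite subr_ge0 (le_trans hx)// ler_wpM2r ?sqr_ge0//.
by rewrite ler_nat.
Qed.

End QuadraticForms.

(** * Scalar differential inequalities *)

Section DifferentialInequalities.
Context {R : realType}.
Implicit Types (f g v df dg dv : R -> R) (a b c t : R).

Lemma nincr_of_derive_le0 f df a b : a <= b ->
  (forall t, a <= t <= b -> is_derive t (1 : R) f (df t)) ->
  (forall t, a <= t <= b -> df t <= 0) -> f b <= f a.
Proof.
move=> ab fD df0.
have oc t : t \in `]a, b[ -> a <= t <= b.
  by rewrite in_itv/= => /andP[/ltW -> /ltW ->].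
apply: (@ler0_derive1_nincr R f a b) => //.
- by move=> t /oc /fD [].
- by move=> t /oc tab; have [_ fE] := fD t tab; rewrite derive1E fE df0.
- apply: derivable_within_continuous => t; rewrite in_itv/= => /fD [].
  by [].
Qed.

(** The differential Gronwall inequality: [g t * expR (- c * (t - a))] is
    nonincreasing. *)
Lemma expR_bound g dg a b c : a <= b ->
  (forall t, a <= t <= b -> is_derive t (1 : R) g (dg t)) ->
  (forall t, a <= t <= b -> dg t <= c * g t) ->
  g b <= g a * expR (c * (b - a)).
Proof.
move=> ab gD dgc.
pose f t := g t * expR (- c * (t - a)).
suff : f b <= f a.
  rewrite /f subrr mulr0 expR0 mulr1 => h.
  rewrite -[leLHS]mulr1 -(expRxMexpNx_1 (c * (b - a))) mulrCA mulrC.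
  by rewrite -mulNr ler_wpM2r ?expR_ge0.
pose e t := expR (- c * (t - a)).
apply: (@nincr_of_derive_le0 f (fun t => (dg t - c * g t) * e t)) => //.
  move=> t tab; have gDt := gD t tab.
  have eD : is_derive t (1 : R) e (- c * e t).
    have lD : is_derive t (1 : R) (fun s => - c * (s - a)) (- c).
      have iD := is_deriveB (is_derive_id t (1 : R)) (is_derive_cst a t (1 : R)).
      apply: is_derive_eq (is_deriveZ (- c) iD) _.
      by rewrite subr0 [LHS]mulr1.
    have := @is_derive1_comp R expR (fun s => - c * (s - a)) t _ _
      (is_derive_expR _) lD.
    by move=> h; apply: is_derive_eq h _; rewrite mulrC.
  apply: is_derive_eq (is_deriveM gDt eD) _.
  by rewrite /GRing.scale/=; ring.
move=> t tab; rewrite mulr_le0_ge0 ?expR_ge0//.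
by rewrite subr_le0 dgc.
Qed.

Lemma expR_lower_bound g dg a b c : a <= b ->
  (forall t, a <= t <= b -> is_derive t (1 : R) g (dg t)) ->
  (forall t, a <= t <= b -> - (c * g t) <= dg t) ->
  g a * expR (- c * (b - a)) <= g b.
Proof.
move=> ab gD dgc; rewrite -lerN2 -mulNr.
apply: (@expR_bound (- g) (fun t => - dg t)) => // t tab.
  by have := gD t tab => gDt; exact: is_deriveN.
by rewrite mulrNN lerNl dgc.
Qed.

(** A relative bound on the derivative in both directions of time prevents [g]
    from leaving the value zero, forwards by the upper and backwards by the
    lower exponential estimate. *)
Lemma gronwall_zero (I : set R) g dg c : is_interval I ->
  (forall t, I t -> is_derive t (1 : R) g (dg t)) ->
  (forall t, I t -> `|dg t| <= c * g t) ->
  (forall t, I t -> 0 <= g t) ->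
  forall t0 t, I t0 -> I t -> g t0 = 0 -> g t = 0.
Proof.
move=> Iitv gD dgc g0 t0 t It0 It gt0.
apply/eqP; rewrite eq_le g0// andbT.
have [tt0|/ltW tt0] := leP t0 t.
  have sub s : t0 <= s <= t -> I s by exact: Iitv.
  have := @expR_bound g dg t0 t c tt0; rewrite gt0 mul0r; apply => s /sub Is.
    exact: gD.
  exact: le_trans (ler_norm _) (dgc _ Is).
have sub s : t <= s <= t0 -> I s by exact: Iitv.
have := @expR_lower_bound g dg t t0 c tt0; rewrite gt0.
rewrite pmulr_lle0 ?expR_gt0//; apply => s /sub Is.
  exact: gD.
by have := dgc _ Is; rewrite ler_norml => /andP[].
Qed.

(** The Lyapunov function [v] decreases to a limit, so its drop over a time
    interval of length one tends to zero; and this drop dominates a multiple of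
    [g] at the start of the interval, since [g] decays at most exponentially. *)
Lemma lyapunov_cvg0 g dg v dv t0 c eps : 0 < eps ->
  (forall t, t0 <= t -> is_derive t (1 : R) g (dg t)) ->
  (forall t, t0 <= t -> is_derive t (1 : R) v (dv t)) ->
  (forall t, t0 <= t -> 0 <= g t) -> (forall t, t0 <= t -> 0 <= v t) ->
  (forall t, t0 <= t -> `|dg t| <= c * g t) ->
  (forall t, t0 <= t -> dv t <= - eps * g t) ->
  g t @[t --> +oo] --> 0.
Proof.
move=> eps0 gD vD g0 v0 dgc dve.
pose c' := Num.max c 0.
have dgc' t : t0 <= t -> - (c' * g t) <= dg t.
  move=> t0t; have := dgc t t0t; rewrite ler_norml => /andP[+ _].
  by apply: le_trans; rewrite lerN2 ler_wpM2r ?g0// le_max lexx.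
pose k := eps * expR (- c').
have k0 : 0 < k by rewrite mulr_gt0 ?expR_gt0.
(* compare with the affine function of slope - k g t on [t, t + 1] *)
have drop t : t0 <= t -> k * g t <= v t - v (t + 1).
  move=> t0t; have tt1 : t <= t + 1 by rewrite lerDl.
  have := @nincr_of_derive_le0 (fun s => v s + s * (k * g t))
    (fun s => dv s + k * g t) t (t + 1) tt1.
  move=> h; suff : v (t + 1) + (t + 1) * (k * g t) <= v t + t * (k * g t) by lra.
  apply: h => s /andP[ts st]; have t0s := le_trans t0t ts.
    have vDs := vD s t0s.
    apply: is_deriveD.
    apply: is_derive_eq.
    by rewrite scaler0 add0r [LHS]mulr1.
  have := dve s t0s.
  have gs : g t * expR (- c') <= g s.
    apply: le_trans (expR_lower_bound (c := c') ts _ _).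
    - rewrite ler_wpM2l ?g0// ler_expR mulNr lerN2 -[leRHS]mulr1 ler_wpM2l//.
        by rewrite le_max lexx orbT.
      lra.
    - by move=> r /andP[tr _]; apply: gD; exact: le_trans tr.
    - by move=> r /andP[tr _]; apply: dgc'; exact: le_trans tr.
  rewrite /k -mulrA (mulrC _ (g t)).
  have := ler_wpM2l (ltW eps0) gs.
  lra.
have vn s t : t0 <= s -> s <= t -> v t <= v s.
  move=> t0s st; apply: (@nincr_of_derive_le0 v dv) => // r /andP[sr _].
    by apply: vD; exact: le_trans sr.
  have t0r := le_trans t0s sr.
  by rewrite (le_trans (dve r t0r))// mulNr oppr_le0 mulr_ge0 ?g0// ltW.
pose S := [set v t | t in `[t0, +oo[].
have Sinf : has_inf S.
  split; first by exists (v t0), t0 => //=; rewrite in_itv/= lexx.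
  by exists 0 => _ [t /= + <-]; rewrite in_itv/= andbT => /v0.
apply/cvgrPdist_lt => e e0.
have [_ [T /= + <-] vT] := inf_adherent (mulr_gt0 k0 e0) Sinf.
rewrite in_itv/= andbT => t0T.
near=> t.
have Tt : T <= t by near: t; apply: nbhs_pinfty_ge; exact: num_real.
have t0t := le_trans t0T Tt.
rewrite sub0r normrN ger0_norm ?g0// -(ltr_pM2l k0).
apply: le_lt_trans (drop t t0t) _.
have vt1 : inf S <= v (t + 1).
  apply: ge_inf; first by case: Sinf.
  by exists (t + 1) => //=; rewrite in_itv/= andbT; lra.
by have := vn _ _ t0T Tt; lra.
Unshelve. all: by end_near. Qed.

End DifferentialInequalities.

(** * Derivatives and limits of vector functions *)

Section VectorDerivatives.
Context {R : realType}.

Lemma is_derive_mxP a b (M : R -> 'M[R]_(a, b)) t dM :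
  is_derive t (1 : R) M dM <->
  forall i j, is_derive t (1 : R) (fun s => M s i j) (dM i j).
Proof.
split=> [[Mt <-] i j|Mij].
  have Mtij := (derivable_mxP M t 1).1 Mt i j.
  by apply: DeriveDef => //; rewrite (derive_mx Mt) mxE.
have Mt : derivable M t 1.
  by apply/derivable_mxP => i j; have [] := Mij i j.
apply: DeriveDef => //; rewrite (derive_mx Mt); apply/matrixP => i j.
by rewrite mxE; have [] := Mij i j.
Qed.

Lemma is_derive_mulmx a b (E : 'M[R]_(a, b)) (x : R -> 'cV[R]_b) t dx :
  is_derive t (1 : R) x dx -> is_derive t (1 : R) (fun s => E *m x s) (E *m dx).
Proof.
move=> /is_derive_mxP xD; apply/is_derive_mxP => i j.
have -> : (fun s => (E *m x s) i j) = \sum_k (E i k \*: (fun s => x s k j)).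
  by apply/funext => s; rewrite mxE fct_sumE.
rewrite mxE; apply: is_derive_sum => k; exact: is_deriveZ.
Qed.

Lemma is_derive_col_mx a b (x : R -> 'cV[R]_a) (y : R -> 'cV[R]_b) t dx dy :
  is_derive t (1 : R) x dx -> is_derive t (1 : R) y dy ->
  is_derive t (1 : R) (fun s => col_mx (x s) (y s)) (col_mx dx dy).
Proof.
move=> /is_derive_mxP xD /is_derive_mxP yD; apply/is_derive_mxP => i j.
case: (split_ordP i) => k ->.
  by rewrite col_mxEu; under eq_fun do rewrite col_mxEu.
by rewrite col_mxEd; under eq_fun do rewrite col_mxEd.
Qed.

Lemma is_derive_bform a (A : 'M[R]_a) (w : R -> 'cV[R]_a) t dw : A^T = A ->
  is_derive t (1 : R) w dw ->
  is_derive t (1 : R) (fun s => bform A (w s) (w s)) (2 * bform A (w t) dw).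
Proof.
move=> As wD; have /is_derive_mxP wDi := wD.
have /is_derive_mxP vDi := is_derive_mulmx A wD.
have -> : (fun s => bform A (w s) (w s)) =
    \sum_i ((fun s => w s i 0) * (fun s => (A *m w s) i 0)).
  apply/funext => s; rewrite fct_sumE /bform -mulmxA mxE.
  by apply: eq_bigr => i _; rewrite mxE.
apply: is_derive_eq.
rewrite big_split/=.
have -> : 2 * bform A (w t) dw = bform A (w t) dw + bform A (w t) dw by ring.
congr (_ + _).
  rewrite /bform -mulmxA mxE; apply: eq_bigr => i _.
  by rewrite [in RHS]mxE.
rewrite bformC As /bform -mulmxA mxE; apply: eq_bigr => i _.
by rewrite [in RHS]mxE [LHS]mulrC.
Qed.

End VectorDerivatives.

Lemma cvg0_of_sqn (R : realType) a (f : R -> 'cV[R]_a) (g : R -> R) t0 :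
  (forall t, t0 <= t -> sqn (f t) <= g t) ->
  g t @[t --> +oo] --> 0 -> f t @[t --> +oo] --> (0 : 'cV[R]_a).
Proof.
move=> fg /cvgrPdist_lt g0; apply/cvgrPdist_lt => e e0.
have e20 : 0 < e ^+ 2 by rewrite exprn_gt0.
near=> t.
have t0t : t0 <= t by near: t; apply: nbhs_pinfty_ge; exact: num_real.
have gt : g t < e ^+ 2.
  have : `|0 - g t| < e ^+ 2 by near: t; exact: g0.
  by rewrite sub0r normrN; apply: le_lt_trans; exact: ler_norm.
rewrite sub0r normrN [ltLHS]/Num.Def.normr/= mx_normrE.
rewrite bigmax_lt// => -[i j] _ /=; rewrite ord1.
rewrite -(@ltr_pXn2r _ 2)// ?nnegrE//; last exact: ltW.
rewrite real_normK ?num_real//.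
exact: le_lt_trans (le_sqr_sqn _ _) (le_lt_trans (fg t t0t) gt).
Unshelve. all: by end_near. Qed.

(** * Index-one pencils and the dissipation estimates *)

(** Index at most one means that the nilpotent block of the Weierstrass form
    vanishes. The four transformation matrices (two mutually inverse pairs) are
    produced together because the form is used in both directions. *)
Lemma index_le1_weierstrass (R : fieldType) a b (M N : 'M[R]_(a, b)) nu :
  has_index M N nu -> (nu <= 1)%N ->
  exists rho c (J0 : 'M[R]_rho) (Y : 'M[R]_(a, rho + c)) (S : 'M[R]_(rho + c, a))
    (Z : 'M[R]_(rho + c, b)) (T : 'M[R]_(b, rho + c)),
  [/\ S *m Y = 1%:M /\ Y *m S = 1%:M, Z *m T = 1%:M /\ T *m Z = 1%:M,
      M = Y *m block_mx 1%:M 0 0 0 *m Z & N = Y *m block_mx J0 0 0 1%:M *m Z].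
Proof.
move=> [rho [c [J0 [N0 [[S [T [Si Ti SMT SNT _]] idx]]]]]] nu1.
have N00 : N0 = 0.
  case: eqP idx => [c0 _|_ [nu0 + _]].
    by apply/matrixP => -[i ilt]; exfalso; rewrite c0 in ilt.
  by case: nu nu0 nu1 => [|[|]]// _ _; rewrite expr1.
have [SY YS] := invertible_mxP Si; have [TZ ZT] := invertible_mxP Ti.
move: (pinvmx S) (pinvmx T) SY YS TZ ZT => Y Z SY YS TZ ZT.
exists rho, c, J0, Y, S, Z, T; rewrite N00 in SMT; split=> //.
  by rewrite -SMT !mulmxA YS mul1mx -mulmxA TZ mulmx1.
by rewrite -SNT !mulmxA YS mul1mx -mulmxA TZ mulmx1.
Qed.

Section IndexOneForm.
Context {R : realType} {a b q rho c : nat}.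
Variables (M N : 'M[R]_(a, b)) (B : 'M[R]_(a, q)) (J0 : 'M[R]_rho).
Variables (Y : 'M[R]_(a, rho + c)) (S : 'M[R]_(rho + c, a)).
Variables (Z : 'M[R]_(rho + c, b)) (T : 'M[R]_(b, rho + c)).
Hypotheses (SY : S *m Y = 1%:M) (YS : Y *m S = 1%:M) (ZT : Z *m T = 1%:M).
Hypothesis M_def : M = Y *m block_mx 1%:M 0 0 0 *m Z.
Hypothesis N_def : N = Y *m block_mx J0 0 0 1%:M *m Z.

(** In the coordinates [y = Z1 w] the equation [M w' = N w + B phi] splits into
    an ordinary differential equation, with right-hand side [flow_mx] applied to
    [(y; phi)], and a constraint that is solved for [w] by [graph_mx]. *)
Definition flow_mx : 'M[R]_(rho, rho + q) := row_mx J0 (usubmx (S *m B)).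
Definition graph_mx : 'M[R]_(b, rho + q) :=
  row_mx (lsubmx T) (- (rsubmx T *m dsubmx (S *m B))).

Let Z1 := usubmx Z.

Let ZwE w : Z *m w = col_mx (Z1 *m w) (dsubmx Z *m w) :> 'cV[R]_(rho + c).
Proof. by rewrite -mul_col_mx vsubmxK. Qed.

Lemma dae_mulM w : M *m w = Y *m col_mx (Z1 *m w) (0 : 'cV[R]_c).
Proof.
rewrite M_def -!mulmxA ZwE mul_block_col.
by rewrite !mul0mx mul1mx !addr0.
Qed.

Lemma dae_mulNB w (phi : 'cV[R]_q) : N *m w + B *m phi =
  Y *m col_mx (flow_mx *m col_mx (Z1 *m w) phi)
              (dsubmx Z *m w + dsubmx (S *m B) *m phi).
Proof.
rewrite N_def -!mulmxA ZwE mul_block_col.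
rewrite !mul0mx mul1mx !addr0 add0r /flow_mx mul_row_col -add_col_mx mulmxDr.
by rewrite -mul_col_mx vsubmxK !mulmxA YS mul1mx.
Qed.

Lemma usub_graph y (phi : 'cV[R]_q) : Z1 *m (graph_mx *m col_mx y phi) = y.
Proof.
rewrite /graph_mx mul_row_col mulmxDr mulNmx mulmxN !mulmxA.
have -> : Z1 *m lsubmx T = 1%:M.
  by rewrite mulmx_lsub mul_usub_mx ZT scalar_mx_block; exact: block_mxKul.
have -> : Z1 *m rsubmx T = 0.
  by rewrite mulmx_rsub mul_usub_mx ZT scalar_mx_block; exact: block_mxKur.
by rewrite !mul0mx oppr0 addr0 mul1mx.
Qed.

Lemma dsub_graph y (phi : 'cV[R]_q) :
  dsubmx Z *m (graph_mx *m col_mx y phi) = - (dsubmx (S *m B) *m phi).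
Proof.
rewrite /graph_mx mul_row_col mulmxDr mulNmx mulmxN !mulmxA.
have -> : dsubmx Z *m lsubmx T = 0.
  by rewrite mulmx_lsub mul_dsub_mx ZT scalar_mx_block; exact: block_mxKdl.
have -> : dsubmx Z *m rsubmx T = 1%:M.
  by rewrite mulmx_rsub mul_dsub_mx ZT scalar_mx_block; exact: block_mxKdr.
by rewrite !mul0mx add0r !mul1mx.
Qed.

Lemma dae_solve w dw (phi : 'cV[R]_q) : T *m Z = 1%:M ->
  M *m dw = N *m w + B *m phi ->
  Z1 *m dw = flow_mx *m col_mx (Z1 *m w) phi /\
  w = graph_mx *m col_mx (Z1 *m w) phi.
Proof.
move=> TZ; rewrite dae_mulM dae_mulNB => /(congr1 (mulmx S)).
rewrite !mulmxA SY !mul1mx => /eq_col_mx[-> alg]; split=> //.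
rewrite -[LHS]mul1mx -[RHS]mul1mx -TZ -2!mulmxA; congr (T *m _).
rewrite !ZwE; congr col_mx; first by rewrite usub_graph.
by rewrite dsub_graph; apply/eqP; rewrite -addr_eq0 -alg.
Qed.

(** Every point of the constraint set has an admissible velocity that lies again
    in the projection of the constraint set; this makes the set invariant. *)
Lemma graph_dae y (phi : 'cV[R]_q) :
  M *m (graph_mx *m col_mx (flow_mx *m col_mx y phi) (0 : 'cV[R]_q)) =
  N *m (graph_mx *m col_mx y phi) + B *m phi.
Proof. by rewrite dae_mulM dae_mulNB !usub_graph dsub_graph addNr. Qed.

(** The Wong limit is the largest invariant set in this sense, so it contains
    the whole constraint set. *)
Lemma graph_wongV y (phi : 'cV[R]_q) :
  wongV_lim (row_mx M (0 : 'M[R]_(a, q))) (row_mx N B)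
    (col_mx (graph_mx *m col_mx y phi) phi).
Proof.
move=> i _; elim: i y phi => [//|i IH] y phi /=.
exists (col_mx (graph_mx *m col_mx (flow_mx *m col_mx y phi) 0) 0).
  exact: IH.
by rewrite (mul_row_col M) (mul_row_col N) graph_dae mulmx0 addr0.
Qed.

End IndexOneForm.

Section DissipationEstimates.
Context {R : realType} {a b q : nat}.
Variables (M N P : 'M[R]_(a, b)) (B : 'M[R]_(a, q)) (Q : 'M[R]_(b + q)).
Variable s : 'cV[R]_b -> 'cV[R]_q -> R.
Let Vext := wongV_lim (row_mx M (0 : 'M[R]_(a, q))) (row_mx N B).

(** The algebraic heart of the proof. Strict negativity of [Q] on the constraint
    set gives, with [y] the dynamic component of [w],
      [2 w^T M^T P w' + s <= - e1 (|y|^2 + |phi|^2)].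
    The form [M^T P] sees only the dynamic component, so its value at [(w, w')]
    is bilinear in [y] and [y']; by Young's inequality it cannot be more negative
    than - const [|y|^2] - (e1 / 2) [(|y|^2 + |phi|^2)]. If [s >= 0], comparing
    both bounds shows that [phi], and hence [w] and [y'], are controlled by [y].
    The form [A1] is [|y|^2] expressed in [w]. *)
Lemma dissipation_estimates nu :
  has_index M N nu -> (nu <= 1)%N ->
  M^T *m P = P^T *m M ->
  pos_semidef_on (M^T *m P)
    (mulmx (row_mx 1%:M 0 : 'M[R]_(b, b + q)) @` Vext) ->
  neg_def_on Q Vext ->
  (forall w phi, bform Q (col_mx w phi) (col_mx w phi) =
     2 * bform P^T w (N *m w + B *m phi) + s w phi) ->
  exists (A1 : 'M[R]_b) (c eps K : R), [/\ 0 < eps, A1^T = A1,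
    (forall w, 0 <= bform A1 w w),
    (forall w, M *m w = 0 -> bform A1 w w = 0) &
    forall w dw phi, M *m dw = N *m w + B *m phi -> 0 <= s w phi ->
    [/\ `|2 * bform A1 w dw| <= c * bform A1 w w,
        2 * bform (M^T *m P) w dw <= - eps * bform A1 w w,
        0 <= bform (M^T *m P) w w,
        sqn w <= K * bform A1 w w &
        sqn phi <= K * bform A1 w w]].
Proof.
move=> idx nu1 MPsym MPpos Qneg Qs.
have [rho [c [J0 [Y [S [Z [T [[SY YS] [ZT TZ] M_def N_def]]]]]]]] :=
  index_le1_weierstrass idx nu1.
pose Z1 := usubmx Z; pose U := lsubmx T.
pose Gr : 'M[R]_(b, rho + q) := graph_mx B S T.
pose Fl : 'M[R]_(rho, rho + q) := flow_mx B J0 S.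
have ZGr (y : 'cV_rho) (phi : 'cV_q) : Z1 *m (Gr *m col_mx y phi) = y :=
  usub_graph B S ZT y phi.
have MU (w : 'cV_b) : M *m (U *m (Z1 *m w)) = M *m w.
  have -> : U *m (Z1 *m w) = Gr *m col_mx (Z1 *m w) 0.
    by rewrite /Gr /graph_mx (mul_row_col (lsubmx T)) mulmx0 addr0.
  by rewrite !(dae_mulM M_def) ZGr.
pose L : 'M[R]_(b + q, rho + q) := col_mx Gr (row_mx 0 1%:M).
have LE (y : 'cV_rho) (phi : 'cV[R]_q) :
  L *m col_mx y phi = col_mx (Gr *m col_mx y phi) phi.
  by rewrite mul_col_mx (mul_row_col 0) mul0mx mul1mx add0r.
have Vext_gr (y : 'cV_rho) (phi : 'cV_q) : Vext (col_mx (Gr *m col_mx y phi) phi).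
  exact: (graph_wongV B YS ZT M_def N_def).
have [|e1 e10 He1] := @neg_def_bound R _ (L^T *m Q *m L).
  move=> z; rewrite -(vsubmxK z) bform_mul LE => z0.
  apply: Qneg => //; apply: contra z0.
  rewrite col_mx_eq0 => /andP[/eqP Gr0 /eqP phi0].
  have := ZGr (usubmx z) (dsubmx z); rewrite Gr0 mulmx0 => <-.
  by rewrite phi0 col_mx0.
(* M^T P in the coordinates y *)
pose X := U^T *m (P^T *m M) *m U.
have e40 : 0 < e1 / 4 by rewrite divr_gt0.
have [c1 c10 Hc1] := bform_le (X *m Fl) e40.
have [c2 c20 Hc2] := bform_le Fl (@ltr01 R).
have [c3 c30 Hc3] := sqn_mulmx_le Gr.
pose K1 := 4 * c1 / e1.
have K10 : 0 <= K1 by rewrite /K1 divr_ge0 ?(ltW e10)// mulr_ge0.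
exists (Z1^T *m Z1), (2 * (c2 + 1 + K1)), e1, (c3 * (1 + K1) + K1).
have A1E w v : bform (Z1^T *m Z1) w v = bform 1%:M (Z1 *m w) (Z1 *m v).
  by rewrite -bform_mul mulmx1.
have A1w w : bform (Z1^T *m Z1) w w = sqn (Z1 *m w).
  by rewrite A1E /bform mulmx1 sqnE.
split=> //.
- by rewrite trmx_mul trmxK.
- by move=> w; rewrite A1w sqn_ge0.
- move=> w /(congr1 (mulmx S)); rewrite (dae_mulM M_def) mulmxA SY mul1mx mulmx0.
  move=> /eqP; rewrite col_mx_eq0 => /andP[/eqP Zw0 _].
  by rewrite A1w /Z1 Zw0 /sqn big1// => i _; rewrite mxE expr0n.
move=> w dw phi dae s0; rewrite !A1w A1E.
have [dyE wE] := dae_solve SY YS ZT M_def N_def TZ dae.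
rewrite -/Z1 -/Fl in dyE; rewrite -/Z1 -/Gr in wE.
set y := Z1 *m w in dyE wE *.
have y0 := sqn_ge0 y; have phi0 := sqn_ge0 phi.
have vE : bform (M^T *m P) w dw = bform (X *m Fl) y (col_mx y phi).
  rewrite [RHS]bform_mulr -dyE /X bform_mul [RHS]bform_mulr MU -[RHS]bform_mulr.
  by rewrite -MPsym !bform_mull /y MU.
have diss : 2 * bform (M^T *m P) w dw + s w phi <= - e1 * (sqn y + sqn phi).
  have := He1 (col_mx y phi); rewrite bform_mul LE -wE Qs -dae sqn_col_mx.
  by rewrite -bform_mulr MPsym.
have phi_le : sqn phi <= K1 * sqn y.
  have := Hc1 y (col_mx y phi); rewrite -vE sqn_col_mx ler_norml => /andP[lo _].
  rewrite /K1 mulrAC ler_pdivlMr// mulrC.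
  have : 0 <= e1 * sqn y by rewrite mulr_ge0// ltW.
  lra.
split.
- rewrite dyE -bform_mulr mul1mx normrM ger0_norm// -mulrA ler_wpM2l//.
  have := Hc2 y (col_mx y phi); rewrite sqn_col_mx.
  lra.
- have : 0 <= e1 * sqn phi by rewrite mulr_ge0// ltW.
  lra.
- apply: MPpos; exists (col_mx w phi); first by rewrite wE.
  by rewrite mul_row_col mul1mx mul0mx addr0.
- rewrite wE; apply: le_trans (Hc3 _) _; rewrite sqn_col_mx.
  have : c3 * sqn phi <= c3 * (K1 * sqn y) by rewrite ler_wpM2l.
  have : 0 <= K1 * sqn y by rewrite mulr_ge0.
  lra.
- have : 0 <= c3 * (1 + K1) * sqn y by rewrite !mulr_ge0// addr_ge0.
  lra.
Qed.

End DissipationEstimates.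

(** * The error between observer and system *)

Section SupplyRate.
Context {R : realType} {l n p k qL qM j : nat}.
Variables (A : 'M[R]_(l, n)) (C : 'M[R]_(p, n)) (BL : 'M[R]_(l, qL))
  (BM : 'M[R]_(l, qM)) (F : 'M[R]_(j, n)) (J : 'M[R]_(qM, n))
  (Theta : 'M[R]_qM) (mu delta : R) (P : 'M[R]_(l + p, n + k))
  (K : 'M[R]_(n + k)) (L1 : 'M[R]_(l, k)) (L2 : 'M[R]_(p, k)).

(** The supply rate: the Lipschitz inequality with multiplier [delta] plus the
    monotonicity inequality with multiplier 2, each written as a quantity that is
    nonnegative along the error dynamics. *)
Definition supply (w : 'cV[R]_(n + k)) (phi : 'cV[R]_(qL + qM)) : R :=
  delta * (sqn (F *m usubmx w) - sqn (usubmx phi))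
  + (2 * bform Theta (J *m usubmx w) (dsubmx phi) - mu * sqn (J *m usubmx w)).

(** The gain matrices enter through [P^T calA = P^T hatA + K H], which makes
    the upper left block of [Q] the sum of [P^T calA], its transpose and the terms
    in [F] and [J]. *)
Lemma calQ_form w phi : invertible_mx P ->
  block_mx 0 L1 0 L2 = (pinvmx P)^T *m K *m matH ->
  bform (calQ A C BL BM F J Theta mu delta P K) (col_mx w phi) (col_mx w phi) =
  2 * bform P^T w (calA A C L1 L2 *m w + calB BL BM *m phi) + supply w phi.
Proof.
move=> /invertible_mxP[_ PinvP] L_def.
have cAE : P^T *m calA A C L1 L2 = P^T *m hatA A C + K *m matH.
  have -> : calA A C L1 L2 = hatA A C + block_mx 0 L1 0 L2.
    by rewrite /calA /hatA add_block_mx !addr0 !add0r.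
  by rewrite mulmxDr L_def !mulmxA -trmx_mul PinvP trmx1 mul1mx.
have FE : sqn (calF F *m w) = sqn (F *m usubmx w).
  by rewrite -{1}(vsubmxK w) mul_row_col mul0mx addr0.
have JE : bform (calJ J) w w = sqn (J *m usubmx w).
  rewrite -{1 2}(vsubmxK w) bform_block bform_gram /bform.
  by rewrite !mulmx0 !mul0mx !mxE !addr0.
have ThE : bform (hatTheta J Theta) w phi =
    bform Theta (J *m usubmx w) (dsubmx phi).
  rewrite -bform_mull -{1}(vsubmxK w) -{1}(vsubmxK phi) /bform.
  rewrite -!mulmxA /hatTheta mul_block_col tr_col_mx mul_row_col.
  by rewrite !mul0mx !add0r mulmx0 addr0 !mulmxA.
have LaE : bform (Lambda : 'M[R]_(qL + qM)) phi phi = sqn (usubmx phi).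
  rewrite -{1 2}(vsubmxK phi) bform_block /bform.
  by rewrite !mulmx0 !mul0mx mulmx1 -sqnE !mxE !addr0.
rewrite /calQ bform_block bformDr -!bform_mulr cAE !bformDm !bformNm !bformZm.
rewrite bform_gram FE JE LaE ThE.
rewrite [bform (_^T *m P) w w]bformC [bform (_^T *m _^T) w w]bformC.
rewrite [bform (_^T *m P) phi w]bformC [bform _^T phi w]bformC.
rewrite !trmx_mul !trmxK ThE /supply. ring.
Qed.

Lemma supply_ge0 w phi : 0 < delta ->
  enorm (usubmx phi) <= enorm (F *m usubmx w) ->
  2^-1 * mu * enorm (J *m usubmx w) ^+ 2
    <= bform Theta (J *m usubmx w) (dsubmx phi) ->
  0 <= supply w phi.
Proof.
move=> d0 Lip; rewrite sqn_enorm => Mon.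
apply: addr_ge0; last by lra.
rewrite mulr_ge0 ?(ltW d0)// subr_ge0 -!sqn_enorm.
by rewrite lerXn2r ?nnegrE ?sqrtr_ge0.
Qed.

End SupplyRate.

Section ErrorDynamics.
Context {R : realType} {l n m p k qL qM : nat}.
Variables (E A : 'M[R]_(l, n)) (BL : 'M[R]_(l, qL)) (BM : 'M[R]_(l, qM)).
Variables (J : 'M[R]_(qM, n)) (C : 'M[R]_(p, n)).
Variables (h : 'cV[R]_m -> 'cV[R]_p).
Variables (fL : 'cV[R]_n -> 'cV[R]_m -> 'cV[R]_p -> 'cV[R]_qL).
Variables (fM : 'cV[R]_qM -> 'cV[R]_m -> 'cV[R]_p -> 'cV[R]_qM).
Variables (L1 : 'M[R]_(l, k)) (L2 : 'M[R]_(p, k)).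

(** The system's own state, with zero innovation [d], solves the observer
    equations. *)
Lemma behavior_acceptor : acceptor E A BL BM J C h fL fM L1 L2.
Proof.
move=> I x u y [Iopen xC1 uc yc eqs]; exists x, (cst 0); split=> //.
  split=> //; split=> [t _|]; first exact: derivable_cst.
  have -> : derive1 (cst (0 : 'cV[R]_k)) = cst (0 : 'cV[R]_k) :> (R -> _).
    by apply/funext => t; rewrite derive1E derive_cst.
  by apply: continuous_subspaceT => t; exact: cvg_cst.
move=> t It; have [xE yE] := eqs t It.
rewrite !mulmx0 !addr0 mul_row_col addrA; split=> //.
by rewrite yE opprD addrA subrr add0r addNr.
Qed.

Definition err (x z : R -> 'cV[R]_n) (d : R -> 'cV[R]_k) (t : R) :
  'cV[R]_(n + k) := col_mx (z t - x t) (d t).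

Definition mismatch (x z : 'cV[R]_n) u y : 'cV[R]_(qL + qM) :=
  col_mx (fL z u y - fL x u y) (fM (J *m z) u y - fM (J *m x) u y).

(** The two behaviors may live on different intervals and their external signals
    need only agree at the time considered, as required for solutions that are
    restrictions to a half-line. *)
Lemma error_dae I I' x z d u u' y y' t :
  Sigma_behavior E A BL BM J C h fL fM I x u y ->
  Omega_behavior E A BL BM J C h fL fM L1 L2 I' z d u' y' ->
  I t -> I' t -> u' t = u t -> y' t = y t ->
  exists2 dw, is_derive t (1 : R) (err x z d) dw &
    calE E *m dw = calA A C L1 L2 *m err x z d t
                   + calB BL BM *m mismatch (x t) (z t) (u t) (y t).
Proof.
move=> [_ [xD _] _ _ eqx] [_ [[zD _] [dD _]] _ _ eqz] It I't ut yt.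
have /derivableP xDt := xD t It; have /derivableP zDt := zD t I't.
have /derivableP dDt := dD t I't.
exists (col_mx ('D_1 z t - 'D_1 x t) ('D_1 d t)).
  by apply: is_derive_col_mx; exact: is_deriveB.
have [] := eqx t It; have [] := eqz t I't.
rewrite !derive1E ut yt.
have [_ ->] := is_derive_mulmx E xDt; have [_ ->] := is_derive_mulmx E zDt.
move=> Ez Cz Ex Cx.
rewrite /calE /calA /calB /err /mismatch !mul_block_col !mul_col_mx !mul0mx !addr0.
rewrite add_col_mx addr0; congr col_mx.
  rewrite mulmxBr Ez Ex !mul_row_col !mulmxBr.
  set a1 := A *m z t; set a2 := A *m x t.
  set b1 := BL *m _; set b2 := BM *m _; set b3 := BL *m _; set b4 := BM *m _.
  set e := L1 *m _.
  by apply/matrixP => i i'; rewrite !mxE; ring.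
rewrite mulmxBr; move: Cz; rewrite {1}Cx => ->.
by apply/matrixP => i i'; rewrite !mxE; ring.
Qed.

End ErrorDynamics.

(** * The asymptotic observer *)

Theorem theorem5p1
  (R : realType) (l n m p qL qM j k nV nW : nat)
  (E A : 'M[R]_(l, n)) (BL : 'M[R]_(l, qL)) (BM : 'M[R]_(l, qM))
  (J : 'M[R]_(qM, n)) (C : 'M[R]_(p, n))
  (h : 'cV[R]_m -> 'cV[R]_p)
  (fL : 'cV[R]_n -> 'cV[R]_m -> 'cV[R]_p -> 'cV[R]_qL)
  (fM : 'cV[R]_qM -> 'cV[R]_m -> 'cV[R]_p -> 'cV[R]_qM)
  (F : 'M[R]_(j, n)) (Theta : 'M[R]_qM) (mu delta : R)
  (P : 'M[R]_(l + p, n + k)) (K : 'M[R]_(n + k))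
  (L1 : 'M[R]_(l, k)) (L2 : 'M[R]_(p, k))
  (V : 'M[R]_(n + k, nV)) (W : 'M[R]_(n + k, nW))
  (* the system *)
  (rankJ : \rank J = qM)
  (h_cont : continuous h)
  (fL_cont : continuous
     (fun w : 'cV[R]_n * 'cV[R]_m * 'cV[R]_p => fL w.1.1 w.1.2 w.2))
  (fM_cont : continuous
     (fun w : 'cV[R]_qM * 'cV[R]_m * 'cV[R]_p => fM w.1.1 w.1.2 w.2))
  (fL_Lip : forall (x z : 'cV[R]_n) u y,
     enorm (fL z u y - fL x u y) <= enorm (F *m (z - x)))
  (fM_Mon : forall (x z : 'cV[R]_qM) u y,
     2^-1 * mu * enorm (z - x) ^+ 2
       <= ((z - x)^T *m Theta *m (fM z u y - fM x u y)) 0 0)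
  (* the dimensions and the observer gains *)
  (le_n_lp : (n <= l + p)%N) (k_def : k = (l + p - n)%N)
  (delta_gt0 : 0 < delta) (P_inv : invertible_mx P)
  (L_def : block_mx 0 L1 0 L2 = (pinvmx P)^T *m K *m matH) :
  let cE : 'M[R]_(l + p, n + k) := calE E in
  let cA := calA A C L1 L2 in
  let cB : 'M[R]_(l + p, qL + qM) := calB BL BM in
  let Vext := wongV_lim (row_mx cE (0 : 'M[R]_(l + p, qL + qM))) (row_mx cA cB) in
  let Vbar := mulmx (row_mx 1%:M 0 : 'M[R]_(n + k, (n + k) + (qL + qM))) @` Vext in
  let GL := gain cE cA V W BL in
  let GM := gain cE cA V W BM in
  let tTheta := Theta *m invmx (J *m GM) in
  let Gamma := tTheta + tTheta^T in
  let Gmu := Gamma - mu%:M in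
  let Smx := tTheta^T *m invmx Gmu *m tTheta in
  let Nbar := (row_mx 1%:M 0 : 'M[R]_(n, n + k)) *m row_mx V W in
  let hatB := calM cE cA V W *m block_mx (row_mx BL BM) 0 0 1%:M in
  let G := Gfun Nbar J (dsubmx hatB) h fL fM in
  let Z0 := zero_set G in
  forall
  (V_basis : basis_matrix V (wongV_lim cE cA))
  (W_basis : basis_matrix W (wongW_lim cE cA))
  (Q_neg : neg_def_on (calQ A C BL BM F J Theta mu delta P K) Vext)
  (c1a : cE^T *m P = P^T *m cE /\ pos_semidef_on (cE^T *m P) Vbar)
  (c1b : regular_pencil cE cA /\ exists2 nu, has_index cE cA nu & (nu <= 1)%N)
  (c1c : (0 < qL)%N -> opnorm (F *m GL) < 1)
  (c1d : (0 < qM)%N -> J *m GM \in unitmx /\ lambda_max Gamma < mu)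
  (c1e : (0 < qL)%N -> (0 < qM)%N ->
     exists alpha : R,
       [/\ 0 < alpha,
           (forall x : 'cV[R]_n, enorm (F *m x) <= alpha * enorm (J *m x))
         & alpha * opnorm (J *m GL) / (1 - opnorm (F *m GL))
             * (Num.sqrt (Num.max 0 (lambda_max Smx) / (mu - lambda_max Gamma))
                + opnorm (invmx Gmu *m (tTheta^T - mu%:M))) < 1])
  (c2a : forall x1 x2 u y, Z0 (x1, x2, u, y) ->
     differentiable (G_x2 G x1 u y) x2 /\
     cjacobian (G_x2 G x1 u y) x2 \in unitmx)
  (c2b : exists omega : R -> R,
     [/\ {within `[0, +oo[, continuous omega},
         (forall t, 0 <= t -> 0 < omega t),
         (forall s t, 0 <= s -> s <= t -> omega s <= omega t),
         (\int[lebesgue_measure]_(t in `[0%R, +oo[) ((omega t)^-1)%:E = +oo)%E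
       & forall x1 x2 u y, Z0 (x1, x2, u, y) ->
           differentiable (G_x1uy G x2) (col_mx x1 (col_mx u y)) /\
           opnorm (invmx (cjacobian (G_x2 G x1 u y) x2))
             * opnorm (cjacobian (G_x1uy G x2) (col_mx x1 (col_mx u y)))
             <= omega (enorm x2)])
  (c2c : connected Z0)
  (c2d : forall u y (x : 'cV[R]_qM),
     exists2 U : set 'cV[R]_qM, nbhs x U & [lipschitz (fM z u y) | z in U]),
  asymptotic_observer E A BL BM J C h fL fM L1 L2.
Proof.
move=> cE cA cB Vext Vbar GL GM tTheta Gamma Gmu Smx Nbar hatB G Z0 _ _ Qneg.
move=> [PE PEpos] [_ [nu idx nu1]] _ _ _ _ _ _ _.
have [A1 [c [eps [c' [eps0 A1s A1_ge0 A1_0 est]]]]] :=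
  dissipation_estimates idx nu1 PE PEpos Qneg
    (fun w phi => calQ_form A C BL BM F J Theta mu delta w phi P_inv L_def).
have PEs : (cE^T *m P)^T = cE^T *m P by rewrite trmx_mul trmxK PE.
(* the estimates hold at each time at which both equations are satisfied *)
have err_est I I' x z d u u' y y' t :
    Sigma_behavior E A BL BM J C h fL fM I x u y ->
    Omega_behavior E A BL BM J C h fL fM L1 L2 I' z d u' y' ->
    I t -> I' t -> u' t = u t -> y' t = y t ->
    let w := err x z d in
    [/\ is_derive t (1 : R) w ('D_1 w t),
        `|2 * bform A1 (w t) ('D_1 w t)| <= c * bform A1 (w t) (w t),
        2 * bform (cE^T *m P) (w t) ('D_1 w t)
          <= - eps * bform A1 (w t) (w t),
        0 <= bform (cE^T *m P) (w t) (w t) &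
        sqn (w t) <= c' * bform A1 (w t) (w t)].
  move=> xs zs It I't ut yt w.
  have [dw wD dae] := error_dae xs zs It I't ut yt.
  have [_ ->] := wD.
  have [|? ? ? ?] := est _ _ _ dae; last by split.
  apply: supply_ge0 => //; rewrite /err /mismatch !col_mxKu ?col_mxKd.
    exact: fL_Lip.
  by rewrite mulmxBr; exact: fM_Mon.
have acc : acceptor E A BL BM J C h fL fM L1 L2 by exact: behavior_acceptor.
split; split=> //.
  move=> I t0 x z d u y It0 xs zs Ezx t It.
  have est_I s (Is : I s) := err_est _ _ _ _ _ _ _ _ _ _ xs zs Is Is erefl erefl.
  pose w := err x z d.
  have w0 : bform A1 (w t0) (w t0) = 0.
    apply: A1_0; rewrite /cE /calE /w /err mul_block_col !mul0mx !addr0.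
    by rewrite mulmxBr Ezx subrr col_mx0.
  have [[_ Iitv] _ _ _ _] := xs.
  have gt0 : bform A1 (w t) (w t) = 0.
    apply: (@gronwall_zero _ I (fun s => bform A1 (w s) (w s))
      (fun s => 2 * bform A1 (w s) ('D_1 w s)) c
      Iitv _ _ _ t0) => // s Is; have [wD gb _ _ _] := est_I s Is => //.
    exact: is_derive_bform.
  have [_ _ _ _] := est_I t It; rewrite -/(w t) gt0 mulr0 => wt0.
  have : w t = 0 by apply: sqn_eq0; apply/eqP; rewrite eq_le wt0 sqn_ge0.
  by rewrite /w /err -[RHS]col_mx0 => /eq_col_mx[/eqP + _]; rewrite subr_eq0 => /eqP.
move=> t0 x z d u y [I [x' [u1 [y1 [t0I xs xE]]]]].
move=> [I' [z' [d' [u2 [y2 [t0I' zs zE]]]]]].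
pose w := err x' z' d'.
have est_t t (t0t : t0 <= t) : [/\ is_derive t (1 : R) w ('D_1 w t),
        `|2 * bform A1 (w t) ('D_1 w t)| <= c * bform A1 (w t) (w t),
        2 * bform (cE^T *m P) (w t) ('D_1 w t)
          <= - eps * bform A1 (w t) (w t),
        0 <= bform (cE^T *m P) (w t) (w t) &
        sqn (w t) <= c' * bform A1 (w t) (w t)].
  have tI : `[t0, +oo[%classic t by rewrite /= in_itv/= andbT.
  have [_ ux yx] := xE t t0t; have [_ _ uz yz] := zE t t0t.
  by apply: (err_est _ _ _ _ _ _ _ _ _ _ xs zs (t0I _ tI) (t0I' _ tI));
    [rewrite -ux|rewrite -yx].
have g0 : bform A1 (w t) (w t) @[t --> +oo] --> 0.
  apply: (lyapunov_cvg0 (t0 := t0) (eps := eps) (c := c)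
    (dg := fun t => 2 * bform A1 (w t) ('D_1 w t))
    (v := fun t => bform (cE^T *m P) (w t) (w t))
    (dv := fun t => 2 * bform (cE^T *m P) (w t) ('D_1 w t))) => // t /est_t[] //.
    by move=> wD _ _ _ _; exact: is_derive_bform.
  by move=> wD _ _ _ _; exact: is_derive_bform.
apply: (@cvg0_of_sqn _ _ _ (fun t => c' * bform A1 (w t) (w t)) t0).
  move=> t t0t; have [_ _ _ _] := est_t t t0t; apply: le_trans.
  have [-> _ _] := xE t t0t; have [-> _ _ _] := zE t t0t.
  by rewrite /w /err sqn_col_mx lerDl sqn_ge0.
by rewrite -(mulr0 c'); apply: cvgM => //; exact: cvg_cst.
Qed.
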